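(* Let $I$ be a right ideal of $\mathbb{H}[q_1,\ldots,q_n]$. If $\mathcal{V}_c(I)$ is irreducible, then $\mathcal{V}(I)$ is irreducible.
   Context: $\mathbb{H}$ is the skew field of quaternions, $\mathbb{S}=\{J\in\mathbb{H}: J^2=-1\}$, and for $K\in\mathbb{S}$, $\mathbb{C}_K=\mathbb{R}+\mathbb{R}K$. $\mathbb{H}[q_1,\ldots,q_n]$ is the set of slice regular polynomials, i.e. functions $P:\mathbb{H}^n\to\mathbb{H}$, $P(q_1,\ldots,q_n)=\sum q_1^{\ell_1}\cdots q_n^{\ell_n}a_{\ell_1,\ldots,\ell_n}$ (finite sum, variables in this order, coefficients in $\mathbb{H}$ on the right). It is a ring under pointwise sum and the $*$-product determined by $(q^{\ell}a)*(q^{m}b)=q^{\ell+m}ab$ for multi-indices $\ell,m$, where $q^\ell=q_1^{\ell_1}\cdots q_n^{\ell_n}$. For a right ideal $I$, $\mathcal{V}(I)\subseteq\mathbb{H}^n$ is the set of common zeros of all $P\in I$, and $\mathcal{V}_c(I)=\mathcal{V}(I)\cap\bigcup_{K\in\mathbb{S}}\mathbb{C}_K^n$. A set $\mathcal{V}(I)$ is reducible if there exist proper, non-trivial right ideals $I_1,I_2$ of $\mathbb{H}[q_1,\ldots,q_n]$ with $\mathcal{V}(I)=\mathcal{V}(I_1)\cup\mathcal{V}(I_2)$, where neither of $\mathcal{V}(I_1),\mathcal{V}(I_2)$ is contained in the other; otherwise it is irreducible. Analogously, $\mathcal{V}_c(I)$ is reducible if there exist proper, non-trivial right ideals $I_1,I_2$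 with $\mathcal{V}_c(I)=\mathcal{V}_c(I_1)\cup\mathcal{V}_c(I_2)$, where neither of $\mathcal{V}_c(I_1),\mathcal{V}_c(I_2)$ is contained in the other; otherwise it is irreducible. *)

(* Defs.v *)
From HB Require Import structures.
From mathcomp Require Import all_boot all_order all_algebra.
From mathcomp Require Import ring lra mpoly.
From mathcomp Require Import classical_sets reals.

Set Implicit Arguments.
Unset Strict Implicit.
Unset Printing Implicit Defensive.

Import Order.TTheory GRing.Theory Num.Theory.
Local Open Scope ring_scope.
Local Open Scope classical_set_scope.

(* [Quat a b c d] is the quaternion a + b i + c j + d k. *)
Record quat (R : Type) := Quat { qre : R; qi : R; qj : R; qk : R }.
Arguments Quat {R} qre qi qj qk.

Section QuatRing.
Variable R : realType.
Local Notation H := (quat R).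
Implicit Types x y z : H.

Definition quat_tuple x := (qre x, qi x, qj x, qk x).
Definition tuple_quat (t : R * R * R * R) : H :=
  Quat t.1.1.1 t.1.1.2 t.1.2 t.2.

Fact quat_tupleK : cancel quat_tuple tuple_quat.
Proof. by case. Qed.

HB.instance Definition _ := Choice.copy H (can_type quat_tupleK).

Definition qadd x y :=
  Quat (qre x + qre y) (qi x + qi y) (qj x + qj y) (qk x + qk y).
Definition qopp x := Quat (- qre x) (- qi x) (- qj x) (- qk x).
Definition qmul x y := Quat
  (qre x * qre y - qi x * qi y - qj x * qj y - qk x * qk y)
  (qre x * qi y + qi x * qre y + qj x * qk y - qk x * qj y)
  (qre x * qj y - qi x * qk y + qj x * qre y + qk x * qi y)
  (qre x * qk y + qi x * qj y - qj x * qi y + qk x * qre y).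

Fact qaddA : associative qadd.
Proof. by move=> [????] [????] [????]; congr Quat; rewrite /= addrA. Qed.
Fact qaddC : commutative qadd.
Proof. by move=> [????] [????]; congr Quat; rewrite /= addrC. Qed.
Fact qadd0 : left_id (Quat 0 0 0 0) qadd.
Proof. by move=> [????]; congr Quat; rewrite /= add0r. Qed.
Fact qaddN : left_inverse (Quat 0 0 0 0) qopp qadd.
Proof. by move=> [????]; congr Quat; rewrite /= addNr. Qed.

HB.instance Definition _ := GRing.isZmodule.Build H qaddA qaddC qadd0 qaddN.

Fact qmulA : associative qmul.
Proof. by move=> [????] [????] [????]; congr Quat; rewrite /=; ring. Qed.
Fact qmul1l : left_id (Quat 1 0 0 0) qmul.
Proof. by move=> [????]; congr Quat; rewrite /=; ring. Qed.
Fact qmul1r : right_id (Quat 1 0 0 0) qmul.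
Proof. by move=> [????]; congr Quat; rewrite /=; ring. Qed.
Fact qmulDl : left_distributive qmul +%R.
Proof. by move=> [????] [????] [????]; congr Quat; rewrite /=; ring. Qed.
Fact qmulDr : right_distributive qmul +%R.
Proof. by move=> [????] [????] [????]; congr Quat; rewrite /=; ring. Qed.
Fact qone_neq0 : Quat 1 0 0 0 != 0 :> H.
Proof. by apply/eqP => -[] /eqP; rewrite oner_eq0. Qed.

HB.instance Definition _ := GRing.Zmodule_isNzRing.Build H
  qmulA qmul1l qmul1r qmulDl qmulDr qone_neq0.

Definition qnorm2 x := qre x ^+ 2 + qi x ^+ 2 + qj x ^+ 2 + qk x ^+ 2.

Definition qinv x := let N := qnorm2 x in
  Quat (qre x / N) (- qi x / N) (- qj x / N) (- qk x / N).

Fact qnorm2_neq0 x : x != 0 -> qnorm2 x != 0.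
Proof.
apply: contra => /eqP; rewrite /qnorm2 => N0; apply/eqP.
case: x N0 => a b c d /= N0.
have [a0 b0 c0 d0] : [/\ a ^+ 2 = 0, b ^+ 2 = 0, c ^+ 2 = 0 & d ^+ 2 = 0].
  have := sqr_ge0 a; have := sqr_ge0 b; have := sqr_ge0 c; have := sqr_ge0 d.
  by split; lra.
have sq0 (e : R) : e ^+ 2 = 0 -> e = 0 by move=> /eqP; rewrite sqrf_eq0 => /eqP.
by rewrite (sq0 _ a0) (sq0 _ b0) (sq0 _ c0) (sq0 _ d0).
Qed.

Fact qmulVx : {in predC1 (0 : H), left_inverse 1 qinv *%R}.
Proof.
move=> x /qnorm2_neq0 N0; rewrite /qinv; move: N0; rewrite /qnorm2.
by case: x => a b c d /= N0; congr Quat; rewrite /=; field.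
Qed.
Fact qmulxV : {in predC1 (0 : H), right_inverse 1 qinv *%R}.
Proof.
move=> x /qnorm2_neq0 N0; rewrite /qinv; move: N0; rewrite /qnorm2.
by case: x => a b c d /= N0; congr Quat; rewrite /=; field.
Qed.
Fact qunitP x y : y * x = 1 /\ x * y = 1 -> x \in predC1 0.
Proof.
case=> yx1 _; rewrite inE; apply/eqP => x0.
by move/eqP: yx1; rewrite x0 mulr0 eq_sym oner_eq0.
Qed.
Fact qinv_out : {in [predC predC1 (0 : H)], qinv =1 id}.
Proof.
move=> x; rewrite !inE negbK => /eqP ->.
by congr Quat; rewrite /= ?oppr0 mul0r.
Qed.

HB.instance Definition _ :=
  GRing.NzRing_hasMulInverse.Build H qmulVx qmulxV qunitP qinv_out.

Lemma quat_unitE x : (x \is a GRing.unit) = (x != 0).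
Proof. by []. Qed.

Definition qreal (a : R) : H := Quat a 0 0 0.

Definition imag_sphere : set H := [set J | J ^+ 2 = -1].

Definition slice (K : H) : set H :=
  [set x | exists a b : R, x = qreal a + qreal b * K].

End QuatRing.

(* Slice regular polynomials are represented by their coefficients: the product
   of {mpoly H[n]} keeps the variables central and multiplies coefficients in
   order, i.e. it is the *-product (lemma [star_monomial] below). A polynomial
   is determined by its values on H^n (lemma [sr_eval_inj] below), so this is
   the same as working with polynomial functions. *)
Section SliceRegularPolynomials.
Variables (R : realType) (n : nat).
Local Notation H := (quat R).
Implicit Types (P Q : {mpoly H[n]}) (I : set {mpoly H[n]}).

(* [\prod_(i < n)] multiplies in increasing order of i. *)
Definition sr_eval P (v : 'I_n -> H) : H :=
  \sum_(m <- msupp P) (\prod_(i < n) v i ^+ m i) * P@_m.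

Definition right_ideal I : Prop :=
  [/\ I 0, (forall P Q, I P -> I Q -> I (P + Q))
    & forall P Q, I P -> I (P * Q)].

Definition proper_nontrivial I : Prop := I <> setT /\ I <> [set 0].

Definition zeros I : set ('I_n -> H) :=
  [set v | forall P, I P -> sr_eval P v = 0].

Definition slice_points : set ('I_n -> H) :=
  \bigcup_(K in @imag_sphere R) [set v | forall i, slice K (v i)].

Definition zeros_c I : set ('I_n -> H) := zeros I `&` slice_points.

Definition reducible_for (Z : set {mpoly H[n]} -> set ('I_n -> H)) I : Prop :=
  exists I1 I2 : set {mpoly H[n]},
    [/\ right_ideal I1 /\ proper_nontrivial I1,
        right_ideal I2 /\ proper_nontrivial I2,
        Z I = Z I1 `|` Z I2,
        ~ (Z I1 `<=` Z I2)
      & ~ (Z I2 `<=` Z I1)].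

Definition zeros_irreducible I : Prop := ~ reducible_for zeros I.

Definition zeros_c_irreducible I : Prop := ~ reducible_for zeros_c I.

Lemma star_monomial (l m : 'X_{1..n}) (a b : H) :
  (a *: 'X_[l]) * (b *: 'X_[m]) = (a * b) *: 'X_[l + m] :> {mpoly H[n]}.
Proof.
rewrite -!mul_mpolyC mpolyCM mpolyXD !mulrA; congr (_ * _).
by rewrite -!mulrA -commr_mpolyX.
Qed.

Lemma sr_eval_wide P (s : seq 'X_{1..n}) v : uniq s -> {subset msupp P <= s} ->
  sr_eval P v = \sum_(m <- s) (\prod_(i < n) v i ^+ m i) * P@_m.
Proof.
move=> us sub; rewrite (bigID (mem (msupp P))) /= [X in _ + X]big1 ?addr0.
  rewrite -big_filter /sr_eval; apply/perm_big/uniq_perm.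
  - exact: msupp_uniq.
  - exact: filter_uniq.
  by move=> m; rewrite mem_filter; case: (boolP (m \in _)) => // /sub ->.
by move=> m /memN_msupp_eq0 ->; rewrite mulr0.
Qed.

Lemma sr_evalD P Q v : sr_eval (P + Q) v = sr_eval P v + sr_eval Q v.
Proof.
pose s := undup (msupp P ++ msupp Q ++ msupp (P + Q)).
have us : uniq s by exact: undup_uniq.
rewrite !(@sr_eval_wide _ s) ?undup_uniq// => [|m Hm|m Hm|m Hm];
  rewrite ?mem_undup ?mem_cat ?Hm ?orbT//.
by rewrite -big_split; apply: eq_bigr => m _; rewrite mcoeffD mulrDr.
Qed.

Lemma sr_eval_monomial (l : 'X_{1..n}) (a : H) v :
  sr_eval (a *: 'X_[l]) v = (\prod_(i < n) v i ^+ l i) * a.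
Proof.
rewrite (@sr_eval_wide _ [:: l])// => [|m].
  by rewrite big_seq1 mcoeffZ mcoeffX eqxx mulr1.
rewrite mcoeff_msupp mcoeffZ mcoeffX inE (eq_sym l).
by case: (m == l); rewrite ?mulr0 ?eqxx.
Qed.

End SliceRegularPolynomials.

Section EvalInjective.
Variable R : realType.
Local Notation H := (quat R).

Let kron (d n : nat) (f : 'I_n -> nat) : nat := (\sum_(i < n) d ^ i * f i)%N.

Let kron_inj d n (f g : 'I_n -> nat) : (forall i, f i < d)%N ->
  (forall i, g i < d)%N -> kron d f = kron d g -> f =1 g.
Proof.
elim: n f g => [|n IH] f g fd gd; first by move=> _ [].
have d0 : (0 < d)%N by apply: leq_ltn_trans (fd ord0).
have E h : kron d h = (kron d (fun i => h (lift ord0 i)) * d + h ord0)%N.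
  rewrite /kron big_ord_recl expn0 mul1n addnC; congr addn.
  by rewrite big_distrl; apply: eq_bigr => i _ /=; rewrite expnS [RHS]mulnC mulnA.
rewrite !E => e.
have e0 : f ord0 = g ord0.
  by move/(congr1 (modn^~ d)): e; rewrite !modnMDl !modn_small.
have eS : kron d (fun i => f (lift ord0 i)) = kron d (fun i => g (lift ord0 i)).
  by move/(congr1 (divn^~ d)): e; rewrite !divnMDl// !divn_small ?addn0.
move=> i; case: (unliftP ord0 i) => [j|] ->; last exact: e0.
exact: (IH _ _ (fun k => fd _) (fun k => gd _) eS).
Qed.

Let poly_zero_fun (p : {poly R}) : (forall t, p.[t] = 0) -> p = 0.
Proof.
move=> p0; apply/eqP; apply: contraT => pn0.
pose rs := [seq (i%:R : R) | i <- iota 0 (size p)].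
have := max_poly_roots pn0 (_ : all (root p) rs) (_ : uniq rs).
rewrite size_map size_iota ltnn; apply; first by apply/allP => x _; apply/eqP.
by rewrite map_inj_uniq ?iota_uniq// => a b /eqP; rewrite eqr_nat => /eqP.
Qed.

Let qrealM (a b : R) : qreal (a * b) = qreal a * qreal b.
Proof. by congr Quat; rewrite /=; ring. Qed.

Let qrealX (a : R) k : qreal (a ^+ k) = qreal a ^+ k.
Proof. by elim: k => // k IH; rewrite !exprS qrealM IH. Qed.

Let sr_eval_eq0 n (P : {mpoly H[n]}) : (forall v, sr_eval P v = 0) -> P = 0.
Proof.
move=> P0; pose d := msize P.
have ltd m i : m \in msupp P -> (m i < d)%N.
  move=> /msize_mdeg_lt; apply: leq_ltn_trans.
  by rewrite mdegE (bigD1 i)//= leq_addr.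
have ev t : \sum_(m <- msupp P) qreal (t ^+ kron d m) * P@_m = 0.
  rewrite -[RHS](P0 (fun i => qreal (t ^+ (d ^ i)))); apply: eq_bigr => m _.
  congr (_ * _); rewrite /kron (big_morph (GRing.exp t) (exprD t) (expr0 t)).
  rewrite (big_morph (@qreal R) qrealM (erefl : qreal 1 = 1)).
  by apply: eq_bigr => i _; rewrite exprM qrealX.
have comp0 (c : H -> R) : {morph c : x y / x + y} -> c 0 = 0 ->
    (forall a x, c (qreal a * x) = a * c x) ->
    forall m, m \in msupp P -> c P@_m = 0.
  move=> cD c0 cZ m mP.
  pose p := \sum_(m <- msupp P) c P@_m *: 'X^(kron d m) : {poly R}.
  have p0 : p = 0.
    apply: poly_zero_fun => t; rewrite /p horner_sum -[RHS]c0 -(ev t).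
    rewrite (big_morph c cD c0); apply: eq_bigr => l _.
    by rewrite hornerZ hornerXn cZ mulrC.
  have : p`_(kron d m) = 0 by rewrite p0 coef0.
  rewrite /p coef_sum (bigD1_seq m) ?msupp_uniq//= coefZ coefXn eqxx mulr1.
  rewrite big_seq_cond big1 ?addr0// => l /andP[lP lm].
  rewrite coefZ coefXn; case: eqP => [e|]; last by rewrite mulr0.
  case/eqP: lm; apply/mnmP => i; apply/esym.
  by apply: (kron_inj _ _ e) => j; apply: ltd.
apply/mpolyP => m; rewrite mcoeff0.
case: (boolP (m \in msupp P)) => [mP|/memN_msupp_eq0//].
have r0 : qre P@_m = 0.
  by apply: comp0 mP => // a [????] /=; ring.
have i0 : qi P@_m = 0.
  by apply: comp0 mP => // a [????] /=; ring.
have j0 : qj P@_m = 0.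
  by apply: comp0 mP => // a [????] /=; ring.
have k0 : qk P@_m = 0.
  by apply: comp0 mP => // a [????] /=; ring.
by case: P@_m r0 i0 j0 k0 => a b c e /= -> -> -> ->.
Qed.

Lemma sr_eval_inj n (P Q : {mpoly H[n]}) :
  (forall v, sr_eval P v = sr_eval Q v) -> P = Q.
Proof.
move=> PQ; apply/eqP; rewrite -subr_eq0; apply/eqP/sr_eval_eq0 => v.
by apply: (addIr (sr_eval Q v)); rewrite -sr_evalD subrK add0r PQ.
Qed.

End EvalInjective.

(* Main.v *)
From HB Require Import structures.
Require Import Defs.
From mathcomp Require Import all_boot all_order all_algebra.
From mathcomp Require Import ring lra.
From mathcomp Require Import mpoly classical_sets reals boolp.

Set Implicit Arguments.
Unset Strict Implicit.
Unset Printing Implicit Defensive.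

Import Order.TTheory GRing.Theory Num.Theory.
Local Open Scope ring_scope.
Local Open Scope classical_set_scope.

(** The theorem follows from one inclusion principle: the slice points of the
    zero set of a right ideal I control all of its zeros, in the sense that
    if zeros_c I is contained in zeros_c J then zeros I is contained in zeros J
    ([zeros_sub_of_zeros_c]). A decomposition of the zero set of I into two
    incomparable pieces thus restricts to slice points and stays incomparable
    there.

    For the inclusion principle, fix a zero v of I and work in L = H + H iota,
    where iota is a central square root of -1. Each v_i generates a quotient of
    R[t] of dimension at most 2, so over the complex scalars it becomes
    diagonal: 1 = e_i(+) + e_i(-) with v_i e_i(b) = z_i(b) e_i(b) for two
    conjugate central complex numbers z_i(b) ([quat_spectral]). Expanding the
    ordered monomials gives, for every P,

      P(v) = sum over sign vectors f of E_f P(z_f),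
      E_f = e_1(f_1) ... e_n(f_n)

    ([cinj_sr_eval]), where P(z_f) in L is the value of P at a central point.
    Evaluation at z_f turns multiplication of P by the variable q_i into
    multiplication by z_i(f_i), so a right ideal that vanishes at v kills each
    term E_f P(z_f) separately ([splitting_zero]).

    A slice point is obtained from z_f by substituting for iota an element K of
    the sphere of imaginary units, and P vanishes there exactly when
    P(z_f) = A + iota B satisfies A + K B = 0. Now L is the algebra of 2 by 2
    complex matrices, and the right annihilator of E_f in it is 0, L, or one of
    the maximal right ideals { A + iota B : A + K B = 0 }; in every case it is
    the intersection of those maximal right ideals that contain it
    ([annihilator_subst_i]). For each such K, the corresponding slice
    point is a zero of I, hence of J, so E_f P(z_f) = 0 for P in J too, and P(v) = 0. *)

(** * Complexification of a ring *)

(** [Cplx a b] stands for a + iota b with iota central and iota^2 = -1. *)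
Record cplx (A : Type) := Cplx { cre : A; cim : A }.

Section ComplexRing.
Variable A : nzRingType.
Local Notation L := (cplx A).
Implicit Types x y z : L.

Let to_pair x := (cre x, cim x).
Let of_pair (t : A * A) : L := Cplx t.1 t.2.

Let to_pairK : cancel to_pair of_pair.
Proof. by case. Qed.

HB.instance Definition _ := Choice.copy L (can_type to_pairK).

Definition cadd x y := Cplx (cre x + cre y) (cim x + cim y).
Definition copp x := Cplx (- cre x) (- cim x).
Definition cmul x y :=
  Cplx (cre x * cre y - cim x * cim y) (cre x * cim y + cim x * cre y).

Let caddA : associative cadd.
Proof. by move=> [??] [??] [??]; congr Cplx; rewrite /= addrA. Qed.
Let caddC : commutative cadd.
Proof. by move=> [??] [??]; congr Cplx; rewrite /= addrC. Qed.
Let cadd0 : left_id (Cplx 0 0) cadd.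
Proof. by move=> [??]; congr Cplx; rewrite /= add0r. Qed.
Let caddN : left_inverse (Cplx 0 0) copp cadd.
Proof. by move=> [??]; congr Cplx; rewrite /= addNr. Qed.

HB.instance Definition _ := GRing.isZmodule.Build L caddA caddC cadd0 caddN.

Let cmulA : associative cmul.
Proof.
move=> [a b] [c d] [e f]; congr Cplx; rewrite /=.
all: rewrite !mulrDr !mulrDl ?opprD ?mulrN ?mulNr !mulrA.
all: by rewrite [LHS](AC (2*2) ((1*4)*(2*3))).
Qed.
Let cmul1l : left_id (Cplx 1 0) cmul.
Proof. by move=> [??]; congr Cplx; rewrite /= !(mul1r, mul0r, subr0, addr0). Qed.
Let cmul1r : right_id (Cplx 1 0) cmul.
Proof. by move=> [??]; congr Cplx; rewrite /= !(mulr1, mulr0, subr0, add0r). Qed.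
Let cmulDl : left_distributive cmul cadd.
Proof.
by move=> [??] [??] [??]; congr Cplx; rewrite /= !mulrDl ?opprD addrACA.
Qed.
Let cmulDr : right_distributive cmul cadd.
Proof.
by move=> [??] [??] [??]; congr Cplx; rewrite /= !mulrDr ?opprD addrACA.
Qed.
Let cone_neq0 : Cplx 1 0 != 0 :> L.
Proof. by apply/eqP => -[] /eqP; rewrite oner_eq0. Qed.

HB.instance Definition _ := GRing.Zmodule_isNzRing.Build L
  cmulA cmul1l cmul1r cmulDl cmulDr cone_neq0.

Definition cinj (a : A) : L := Cplx a 0.

Let cinj_zmod : {morph cinj : a b / a - b}.
Proof. by move=> a b; congr Cplx; rewrite /= subr0. Qed.
Let cinj_mul : {morph cinj : a b / a * b}.
Proof.
by move=> a b; congr Cplx; rewrite /= !(mulr0, mul0r, subr0, addr0).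
Qed.

HB.instance Definition _ := GRing.isZmodMorphism.Build A L cinj cinj_zmod.
HB.instance Definition _ :=
  GRing.isMonoidMorphism.Build A L cinj (erefl, cinj_mul).

Lemma cplx_eq0 (a b : A) : Cplx a b = 0 <-> a = 0 /\ b = 0.
Proof. by split=> [e|[-> ->]//]; split; [case: e | case: e]. Qed.

Definition central x := forall y, GRing.comm x y.

(** Substituting K for iota in a + iota b; the coefficient b stays on the right,
    as in slice regular polynomials. *)
Definition subst_i (K : A) x : A := cre x + K * cim x.

Lemma subst_i_is_zmod K : {morph subst_i K : x y / x - y}.
Proof. by move=> [a b] [c d]; rewrite /subst_i /= mulrBr opprD addrACA. Qed.

HB.instance Definition _ K :=
  GRing.isZmodMorphism.Build L A (subst_i K) (subst_i_is_zmod K).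

Lemma subst_i_cinj K a : subst_i K (cinj a) = a.
Proof. by rewrite /subst_i mulr0 addr0. Qed.

(** [subst_i K] is not multiplicative in general, because iota is central and K
    is not; it is as soon as the left factor has central components. *)
Lemma subst_iM K x y : K ^+ 2 = -1 -> central x ->
  subst_i K (x * y) = subst_i K x * subst_i K y.
Proof.
case: x y => [a b] [c d] K2 xC.
have aC t : a * t = t * a.
  by have /(congr1 (@cre A)) := xC (cinj t); rewrite /= mulr0 mul0r !subr0.
have bC t : b * t = t * b.
  by have /(congr1 (@cim A)) := xC (cinj t); rewrite /= mulr0 mul0r add0r addr0.
rewrite /subst_i /= mulrDl !mulrDr -!mulrA (mulrA a K) (aC K) (mulrA b K) (bC K).
rewrite -!mulrA (mulrA K K) -expr2 K2 mulN1r.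
by rewrite [LHS](AC (2*2) ((1*3)*(4*2))).
Qed.

End ComplexRing.

(** * Quaternions with complexified scalars *)

Section Quaternions.
Variable R : realType.
Local Notation H := (quat R).
Local Notation L := (cplx H).

Definition complex_scalar (x : L) : Prop :=
  exists a b : R, x = Cplx (qreal a) (qreal b).

Lemma scalar_central x : complex_scalar x -> central x.
Proof.
case=> a [b ->] [[a1 a2 a3 a4] [b1 b2 b3 b4]].
by congr Cplx; congr Quat; rewrite /=; ring.
Qed.

Lemma scalar_slice K x : complex_scalar x -> slice K (subst_i K x).
Proof.
case=> a [b ->]; exists a, b; rewrite /subst_i /=; congr (_ + _).
by case: K => [????]; congr Quat; rewrite /=; ring.
Qed.

(** A nonreal q = a + V, with V purely imaginary of norm s > 0, is a root of a
    real quadratic polynomial with roots a + s iota and a - s iota, and e is the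
    pair of Lagrange idempotents 1/2 - (V / 2s) iota and 1/2 + (V / 2s) iota.
    A real q has a single eigenvalue, and then one idempotent is taken to
    be 0: this last alternative is what makes distinct sign vectors separable
    in [splitting_zero] without grouping equal eigenvalues. *)
Lemma quat_spectral (q : H) : exists z e : bool -> L,
  [/\ forall b, complex_scalar (z b),
      e true + e false = 1,
      forall b, cinj q * e b = z b * e b
    & (exists u, u * (z true - z false) = 1) \/ e false = 0].
Proof.
case: q => a b c d; pose N := b ^+ 2 + c ^+ 2 + d ^+ 2.
have N_ge0 : 0 <= N by rewrite /N !addr_ge0 ?sqr_ge0.
have [N0|N_neq0] := eqVneq N 0.
  have sq0 (t : R) : t ^+ 2 <= 0 -> t = 0.
    by move=> t0; apply/eqP; rewrite -sqrf_eq0 eq_le t0 sqr_ge0.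
  have [b0 c0 d0] : [/\ b = 0, c = 0 & d = 0].
    have := sqr_ge0 b; have := sqr_ge0 c; have := sqr_ge0 d.
    by split; apply: sq0; rewrite /N in N0; lra.
  exists (fun=> cinj (qreal a)), (fun t => if t then 1 else 0); split.
  - by move=> _; exists a, 0.
  - by rewrite addr0.
  - by case; rewrite ?mulr0// b0 c0 d0.
  - by right.
pose s := Num.sqrt N; pose t := (2 * s)^-1.
have s2 : s ^+ 2 = N by rewrite sqr_sqrtr.
have s_neq0 : s != 0 by rewrite -sqrf_eq0 s2.
have st : s * t = 1 / 2 by rewrite /t; field.
have Nt : (b ^+ 2 + c ^+ 2 + d ^+ 2) * t = s / 2.
  by rewrite -/N -s2 /t; field.
exists (fun y => Cplx (qreal a) (qreal (if y then s else - s))).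
exists (fun y => Cplx (qreal (1 / 2))
  (if y then Quat 0 (- t * b) (- t * c) (- t * d)
        else Quat 0 (t * b) (t * c) (t * d))).
have stx x : s * t * x = 1 / 2 * x by rewrite st.
have := stx b; have := stx c; have := stx d => sd sc sb.
split.
- by move=> y; exists a, (if y then s else - s).
- by congr Cplx; congr Quat; rewrite /=; field.
- by case; congr Cplx; congr Quat; rewrite /=; lra.
- left; exists (Cplx 0 (qreal (- t))).
  by congr Cplx; congr Quat; rewrite /=; lra.
Qed.

(** The right annihilator of E is the intersection of the kernels of the
    [subst_i K] that contain it. Write E = E1 + iota E2. If E2 is nonzero, set
    T = E2^-1 E1: then E (C + iota D) = 0 means D = T C and C = - T D, which
    forces (T^2 + 1) C = 0. So either T^2 = -1 and the annihilator is the kernel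
    of [subst_i T], or the annihilator is 0. If E2 = 0, then E is 0 or
    invertible. *)
Lemma annihilator_subst_i (E y : L) :
  (forall K, K ^+ 2 = -1 -> (forall x, E * x = 0 -> subst_i K x = 0) ->
     subst_i K y = 0) ->
  E * y = 0.
Proof.
case: E y => [E1 E2] [A B] hK.
pose i0 : H := Quat 0 1 0 0; pose j0 : H := Quat 0 0 1 0.
have i2 : i0 ^+ 2 = -1 by congr Quat; rewrite /=; ring.
have j2 : j0 ^+ 2 = -1 by congr Quat; rewrite /=; ring.
(* If E is left regular, all K are allowed, and two of them suffice to
   recover both components of y. *)
have inj0 : (forall x, Cplx E1 E2 * x = 0 -> x = 0) ->
    Cplx E1 E2 * Cplx A B = 0.
  move=> Einj.
  have hi : A + i0 * B = 0 by apply: hK => // x /Einj ->; rewrite raddf0.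
  have hj : A + j0 * B = 0 by apply: hK => // x /Einj ->; rewrite raddf0.
  have : (i0 - j0) * B = 0.
    by rewrite mulrBl -[LHS]add0r -{1}(subrr A) addrACA -opprD hi hj subrr.
  have uij : i0 - j0 \is a GRing.unit.
    by rewrite quat_unitE; apply/eqP => -[_ /eqP]; rewrite subr0 oner_eq0.
  move=> /(congr1 (fun x => (i0 - j0)^-1 * x)); rewrite mulKr// mulr0 => B0.
  by move: hi; rewrite B0 mulr0 addr0 => ->; rewrite -[RHS](mulr0 (Cplx E1 E2)).
have [E20|E2_neq0] := eqVneq E2 0.
  have [E10|E1_neq0] := eqVneq E1 0.
    by rewrite E10 E20; apply: mul0r.
  apply: inj0 => -[C D] /cplx_eq0/= [].
  rewrite E20 !mul0r subr0 addr0 => EC ED.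
  have E1u : E1 \is a GRing.unit by rewrite quat_unitE.
  have -> : C = 0 by apply: (mulrI E1u); rewrite mulr0.
  by have -> : D = 0 by apply: (mulrI E1u); rewrite mulr0.
have E2u : E2 \is a GRing.unit by rewrite quat_unitE.
pose T := E2^-1 * E1.
have E1E : E1 = E2 * T by rewrite /T mulVKr.
have annE C D : Cplx E1 E2 * Cplx C D = 0 <-> (D = T * C /\ C = - (T * D)).
  have -> : Cplx E1 E2 * Cplx C D = Cplx (E2 * (T * C - D)) (E2 * (T * D + C)).
    by congr Cplx; rewrite /= E1E !mulrDr ?mulrN !mulrA.
  split=> [/cplx_eq0[h1 h2]|[h1 h2]].
    have t1 : T * C - D = 0 by apply: (mulrI E2u); rewrite mulr0.
    have t2 : T * D + C = 0 by apply: (mulrI E2u); rewrite mulr0.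
    split; first by rewrite -[LHS]add0r -t1 subrK.
    by apply/eqP; rewrite -addr_eq0 addrC t2.
  by rewrite -h1 subrr h2 subrr !mulr0.
have [T2|T2] := eqVneq (T ^+ 2) (-1).
  apply/annE; have: A + T * B = 0.
    apply: hK => // -[C D] /annE[_ CE].
    by rewrite /subst_i /= {1}CE addNr.
  move/eqP; rewrite addr_eq0 => /eqP AE; split=> //.
  by rewrite AE mulrN mulrA -expr2 T2 mulN1r opprK.
apply: inj0 => -[C D] /annE[DE CE].
have uT : T ^+ 2 + 1 \is a GRing.unit by rewrite quat_unitE addr_eq0.
have C0 : C = 0.
  by apply: (mulrI uT); rewrite mulr0 mulrDl mul1r {2}CE DE mulrA -expr2 subrr.
by rewrite DE C0 mulr0.
Qed.

End Quaternions.

(** * Zeros of a right ideal and their slice points *)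

Section Zeros.
Variables (R : realType) (n : nat).
Local Notation H := (quat R).
Local Notation L := (cplx H).
Implicit Types (P : {mpoly H[n]}) (I J : set {mpoly H[n]}).

(** Central evaluation followed by iota := K is evaluation at a point of the
    slice of K. *)
Lemma sr_eval_subst_i (K : H) (z : 'I_n -> L) P : K ^+ 2 = -1 ->
  (forall i, central (z i)) ->
  sr_eval P (fun i => subst_i K (z i)) = subst_i K (mmap (@cinj H) z P).
Proof.
move=> K2 zC; rewrite /sr_eval /mmap raddf_sum; apply: eq_bigr => m _.
have zmC : central (mmap1 z m).
  by move=> y; apply/commr_sym/commr_prod => i _; apply/commrX/commr_sym/zC.
rewrite -(zmC (cinj P@_m)) [RHS]subst_iM// subst_i_cinj; congr (_ * _).
rewrite /mmap1; elim/big_rec2: _ => [|i x y _ ->].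
  by rewrite -[1 in RHS]/(cinj 1) subst_i_cinj.
have zX k : central (z i ^+ k) by move=> t; apply/commr_sym/commrX/commr_sym/zC.
rewrite subst_iM//; congr (_ * _); elim: (m i) => [|k IH].
  by rewrite !expr0 -[1 in RHS]/(cinj 1) subst_i_cinj.
by rewrite !exprS subst_iM// IH.
Qed.

Lemma mmap_mulX (z : 'I_n -> L) P i : (forall i, central (z i)) ->
  mmap (@cinj H) z (P * 'X_i) = z i * mmap (@cinj H) z P.
Proof.
move=> zC; have mM : {morph mmap (@cinj H) z : p q / p * q}.
  apply: (fun h1 h2 => (commr_mmap_is_multiplicative (f := @cinj H) h1 h2).1).
    by move=> j x; apply/commr_sym/zC.
  by move=> Q m m'; apply: commr_prod => j _; apply/commrX/commr_sym/zC.
by rewrite mM mmapX mmap1U zC.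
Qed.

Lemma prod_centralM (A : nzRingType) (k : nat) (x y : 'I_k -> A) :
  (forall i a, GRing.comm (x i) a) ->
  \prod_i (x i * y i) = (\prod_i y i) * (\prod_i x i).
Proof.
move=> xC; elim/big_rec3: _ => [|i a b c _ ->]; first by rewrite mulr1.
by rewrite -!mulrA xC -!mulrA xC.
Qed.

Section Splitting.
Variables (v : 'I_n -> H) (z e : 'I_n -> bool -> L).
Hypothesis zC : forall i b, central (z i b).
Hypothesis eD : forall i, e i true + e i false = 1.
Hypothesis ve : forall i b, cinj (v i) * e i b = z i b * e i b.
Hypothesis z_split : forall i,
  (exists u, u * (z i true - z i false) = 1) \/ e i false = 0.

Local Notation sign := {ffun 'I_n -> bool}.
Implicit Types f g : sign.

Let E f := \prod_i e i (f i).
Let F f P := mmap (@cinj H) (fun i => z i (f i)) P.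

(** Since v_i^k e_i(b) = z_i(b)^k e_i(b), inserting 1 = e_i(+) + e_i(-) after
    each power of v_i and pulling the central z_i(b)^k out of the ordered product
    separates the monomial from the idempotents. *)
Lemma cinj_sr_eval P : cinj (sr_eval P v) = \sum_f E f * F f P.
Proof.
rewrite /sr_eval raddf_sum /F /mmap.
under [RHS]eq_bigr => f _ do rewrite mulr_sumr.
rewrite exchange_big; apply: eq_bigr => m _ /=.
have vXe i b k : cinj (v i) ^+ k * e i b = z i b ^+ k * e i b.
  elim: k => [|k IH]; first by rewrite !expr0.
  by rewrite exprSr -mulrA ve mulrA -(zC i b) -mulrA IH mulrA -exprS.
rewrite rmorphM rmorph_prod.
have -> : \prod_i cinj (v i ^+ m i) = \prod_i \sum_b z i b ^+ m i * e i b.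
  by apply: eq_bigr => i _; rewrite big_bool /= rmorphXn -!vXe -mulrDr eD mulr1.
rewrite bigA_distr_bigA mulr_suml; apply: eq_bigr => f _.
have zmC i b : central (z i b ^+ m i).
  by move=> y; apply/commr_sym/commrX/commr_sym/zC.
rewrite prod_centralM => [|i y]; last exact: zmC.
rewrite -!mulrA; congr (_ * _); apply: commr_sym.
by apply: commr_prod => i _; apply/commr_sym/zmC.
Qed.

(** Terms are isolated one coordinate at a time: the sum of the E f * F f Q over
    the sign vectors f that agree with g on the list s vanishes for every Q
    in I. Combining this for Q q_i and for Q with the weight z_i(- g_i) inserts
    the factor z_i(f_i) - z_i(- g_i), which removes the f with f_i <> g_i and is a
    constant invertible factor on the others; if it is not invertible, then
    e_i(-) = 0 and the terms with f_i = - are zero anyway. *)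
Lemma splitting_zero I : right_ideal I -> zeros I v ->
  forall P f, I P -> E f * F f P = 0.
Proof.
move=> [_ _ IM] Iv P g IP.
pose agree (s : seq 'I_n) f := all (fun i => f i == g i) s.
suff part s Q : I Q -> \sum_(f | agree s f) E f * F f Q = 0.
  rewrite -[RHS](part (enum 'I_n) P IP) (big_pred1 g) // => f.
  apply/allP/eqP => [fg|-> //]; apply/ffunP => i.
  by apply/eqP/fg; rewrite mem_enum.
elim: s Q => [|i s IH] Q IQ.
  by rewrite -cinj_sr_eval Iv // raddf0.
have E0 f : e i (f i) = 0 -> E f = 0.
  move=> e0; rewrite /E.
  have : exists2 j, j \in index_enum 'I_n & e j (f j) = 0.
    by exists i => //; apply: mem_index_enum.
  case=> j; elim: (index_enum _) => // k r IHr; rewrite inE big_cons.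
  by case/orP=> [/eqP-> ->|/IHr h /h ->]; rewrite ?mul0r ?mulr0.
have mulE c f : central c -> E f * (c * F f Q) = c * (E f * F f Q).
  by move=> cC; rewrite !mulrA (cC (E f)).
have opp : \sum_(f | agree s f) (z i (f i) - z i (~~ g i)) * (E f * F f Q) = 0.
  have IQX : \sum_(f | agree s f) E f * (z i (f i) * F f Q) = 0.
    rewrite -[RHS](IH _ (IM _ 'X_i IQ)); apply: eq_bigr => f _.
    by congr (_ * _); apply/esym/mmap_mulX.
  transitivity (\sum_(f | agree s f) E f * (z i (f i) * F f Q)
      - z i (~~ g i) * \sum_(f | agree s f) E f * F f Q); last first.
    by rewrite IQX (IH Q IQ) mulr0 subrr.
  rewrite mulr_sumr -sumrB; apply: eq_bigr => f _.
  by rewrite mulE // mulrBl.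
case: (z_split i) => [[u uz]|ei0]; last first.
  case gi : (g i); last first.
    by apply: big1 => f /= /andP[/eqP fi _]; rewrite E0 ?mul0r // fi gi.
  rewrite -[RHS](IH Q IQ) [RHS](bigID (fun f => f i)) /= [X in _ = _ + X]big1.
    by rewrite addr0; apply: eq_bigl => f; rewrite /= gi eqb_id andbC.
  by move=> f /andP[_ /negbTE fi]; rewrite E0 ?mul0r // fi.
have {}opp : (z i (g i) - z i (~~ g i)) *
    (\sum_(f | agree (i :: s) f) E f * F f Q) = 0.
  rewrite -[RHS]opp [RHS](bigID (fun f => f i == g i)) /=.
  rewrite [X in _ = _ + X]big1 ?addr0 => [|f /andP[_]]; last first.
    by case: (f i) (g i) => [] [] //= _; rewrite subrr mul0r.
  rewrite mulr_sumr; apply: eq_big => f; first by rewrite /= andbC.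
  by case/andP => /eqP ->.
have [w wz] : exists w, w * (z i (g i) - z i (~~ g i)) = 1.
  by case: (g i); [exists u | exists (- u); rewrite mulNr -mulrN opprB].
by move/(congr1 ( *%R w)): opp; rewrite mulrA wz mul1r mulr0.
Qed.

End Splitting.

Lemma zeros_sub_of_zeros_c I J : right_ideal I ->
  zeros_c I `<=` zeros_c J -> zeros I `<=` zeros J.
Proof.
move=> Iid IJ v Iv P JP.
have [z /choice[e ze]] := choice (fun i => quat_spectral (v i)).
have zS i b : complex_scalar (z i b) by case: (ze i).
have zC i b : central (z i b) by apply: scalar_central.
have eD i : e i true + e i false = 1 by case: (ze i).
have ve i b : cinj (v i) * e i b = z i b * e i b by case: (ze i).
have zspl i : (exists u, u * (z i true - z i false) = 1) \/ e i false = 0.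
  by case: (ze i).
suff /(congr1 (@cre H)) : cinj (sr_eval P v) = 0 by [].
rewrite (cinj_sr_eval zC eD ve); apply: big1 => f _.
apply: annihilator_subst_i => K K2 annK.
rewrite -sr_eval_subst_i //; move: P JP.
suff : zeros_c J (fun i => subst_i K (z i (f i))) by case.
apply: IJ; split; last by exists K => // i; apply: scalar_slice.
move=> Q IQ; rewrite sr_eval_subst_i //; apply: annK.
exact: (splitting_zero zC eD ve zspl Iid Iv).
Qed.

End Zeros.

Theorem proposition5p7 (R : realType) (n : nat) (I : set {mpoly (quat R)[n]}) :
  right_ideal I -> zeros_c_irreducible I -> zeros_irreducible I.
Proof.
move=> _ irr [I1 [I2 [[id1 pn1] [id2 pn2] VE n12 n21]]]; apply: irr.
exists I1, I2; split=> //.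
- by rewrite /zeros_c VE setIUl.
- by move/(zeros_sub_of_zeros_c id1).
- by move/(zeros_sub_of_zeros_c id2).
Qed.
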